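(* Let $\varphi:\mathbb{R}_+\to\mathbb{R}_+$ be a strictly convex differentiable admissible function and let $f:X\to\mathbb{R}\cup\{+\infty\}$ be a proper lower semicontinuous convex function on a Banach space $X$. Then $f$ has $\varphi$-SLWP at $\bar x\in{\rm dom}(f)$ if and only if $\partial f$ is strongly metrically $\varphi_+'$-regular at $(\bar x,0)$.
   Context: $\mathbb{R}_+=[0,+\infty)$; $B_X(x,r)$ and $B_X[x,r]$ are the open and closed balls; ${\rm dom}(f)=\{x: f(x)<+\infty\}$; $X^*$ is the dual of $X$, and $f_{u^*}(x):=f(x)-\langle u^*,x\rangle$. Admissible function: a nondecreasing $\varphi:\mathbb{R}_+\to\mathbb{R}_+$ with $\varphi(0)=0$ such that $\varphi(t)\to0$ implies $t\to0$. $\varphi_+'(t):=\lim_{s\to0^+}\frac{\varphi(t+s)-\varphi(t)}{s}$ is the right derivative, which equals $\varphi'$ for differentiable $\varphi$. $\varphi$-SLWP (stable local well-posedness with respect to $\varphi$) of $f$ at $\bar x\in{\rm dom}(f)$: there exist $\delta,r,\tau,\kappa\in(0,+\infty)$ such that for every $u^*\in B_{X^*}(0,\delta)$ there is $x_{u^*}\in B_X[\bar x,r]$, with $x_0=\bar x$, satisfying $\varphi(\kappa\|x-x_{u^*}\|)\le\tau(f_{u^*}(x)-f_{u^*}(x_{u^*}))$ for all $x\in B_X[\bar x,r]$. For convex $f$, $\partial f(x)=\{x^*\in X^*:\langle x^*,y-x\rangle\le f(y)-f(x)\ \forall y\in X\}$ for $x\in{\rm dom}(f)$, and $\partial f(x)=\emptyset$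 otherwise. Metric regularity: let $\psi:\mathbb{R}_+\to\mathbb{R}_+$ be an admissible function and $F:X\rightrightarrows Y$ a multifunction between Banach spaces, $F^{-1}(y)=\{x: y\in F(x)\}$. $F$ is strongly metrically $\psi$-regular at $(\bar x,\bar y)$ if $\bar y\in F(\bar x)$ and there exist $r,\tau,\kappa,\delta\in(0,+\infty)$ such that $\psi(\tau d(x,F^{-1}(y)))\le\kappa d(y,F(x))$ for all $(x,y)\in B_X(\bar x,r)\times B_Y(\bar y,r)$ and $F^{-1}(y)\cap B_X(\bar x,\delta)$ is a singleton for all $y\in B_Y(\bar y,r)$. This notion is applied here with $\psi=\varphi_+'$. Here $d(x,A)=\inf_{a\in A}\|x-a\|$, $d(x,\emptyset)=+\infty$, and $\psi(+\infty):=\lim_{t\to+\infty}\psi(t)$.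
   Formalization: The formal statement also assumes that φ'_+ is admissible (equivalently φ'_+(0)=0), as the definition of metric regularity requires; without this the claim fails, e.g. for φ(t)=t+t², f=|·| on the real line, x̄=0. *)

(* Defs.v *)
From HB Require Import structures.
From mathcomp Require Import all_boot all_order all_algebra.
From mathcomp Require Import all_classical all_reals all_analysis.

Set Implicit Arguments.
Unset Strict Implicit.
Unset Printing Implicit Defensive.

Import Order.TTheory GRing.Theory Num.Theory.
Import numFieldNormedType.Exports.

Local Open Scope classical_set_scope.
Local Open Scope ring_scope.

Section dual_lmodule.
Context {R : realType} {X : normedModType R}.

Definition continuous_linear : {pred X -> R^o} :=
  mem [set f : X -> R^o | linear f /\ continuous f].

Lemma continuous_linear_submod : submod_closed continuous_linear.
Proof.
split=> [|a f g /[!inE] -[lf cf] [lg cg]].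
  rewrite inE; split; last exact: cst_continuous.
  by move=> a x y; rewrite /= scaler0 addr0.
split=> [b x y|x]; last first.
  apply: (@continuousD _ _ _ (a \*: f) g); last exact: cg.
  by apply: continuousZl_tmp; exact: cf.
rewrite [LHS]/(a *: f (b *: x + y) + g (b *: x + y)) lf lg !scalerDr addrACA.
by congr (_ + _); rewrite !scalerA mulrC.
Qed.

HB.instance Definition _ := GRing.isSubmodClosed.Build R (X -> R^o)
  continuous_linear continuous_linear_submod.

End dual_lmodule.

Record dual_space (R : realType) (X : normedModType R) := Dual {
  dual_fun :> X -> R^o ;
  dual_funP : dual_fun \in continuous_linear }.

Section dual_norm.
Context {R : realType} {X : normedModType R}.

HB.instance Definition _ := [isSub for @dual_fun R X].
HB.instance Definition _ := [Choice of dual_space X by <:].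
HB.instance Definition _ := [SubChoice_isSubLmodule of dual_space X by <:].

Implicit Types u v : dual_space X.

Definition dual_norm u : R := sup [set `|u x| | x in [set x : X | `|x| <= 1]].

Lemma dual_linear u : linear u.
Proof. by have := dual_funP u; rewrite inE => -[]. Qed.

Lemma dual_continuous u : continuous u.
Proof. by have := dual_funP u; rewrite inE => -[]. Qed.

HB.instance Definition _ u :=
  GRing.isLinear.Build R X R^o _ (dual_fun u) (dual_linear u).

Lemma dualD u v x : (u + v) x = u x + v x. Proof. by []. Qed.
Lemma dualZ (a : R) u x : (a *: u) x = a * u x. Proof. by []. Qed.

Lemma dual_norm_has_sup u :
  has_sup [set `|u x| | x in [set x : X | `|x| <= 1]].
Proof.
split; first by exists `|u 0|, 0 => //=; rewrite normr0.
have /linear_bounded_continuous/bounded_funP/(_ 1)[M uM] := @dual_continuous u.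
by exists M => _ [x x1 <-]; exact: uM.
Qed.

Lemma dual_norm_ge u x : `|x| <= 1 -> `|u x| <= dual_norm u.
Proof.
by move=> x1; apply: ub_le_sup; [case: (dual_norm_has_sup u)|exists x].
Qed.

Lemma dual_norm_le u M :
  (forall x, `|x| <= 1 -> `|u x| <= M) -> dual_norm u <= M.
Proof.
move=> uM; apply: ge_sup; first by case: (dual_norm_has_sup u).
by move=> _ [x x1 <-]; exact: uM.
Qed.

Lemma dual_norm_ge0 u : 0 <= dual_norm u.
Proof. by rewrite (le_trans _ (@dual_norm_ge u 0 _)) ?normr0. Qed.

Lemma dual_normP u x : `|u x| <= dual_norm u * `|x|.
Proof.
have [->|x0] := eqVneq x 0; first by rewrite linear0 !normr0 mulr0.
have /dual_norm_ge : `| `|x|^-1 *: x| <= 1.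
  by rewrite normrZ normfV normr_id mulVf// normr_eq0.
move=> /(_ u); rewrite linearZ/= normrM normfV normr_id.
by rewrite ler_pdivrMl ?normr_gt0// mulrC.
Qed.

Lemma dual_normD u v : dual_norm (u + v) <= dual_norm u + dual_norm v.
Proof.
apply: dual_norm_le => x x1; rewrite dualD (le_trans (ler_normD _ _))//.
by rewrite lerD// dual_norm_ge.
Qed.

Lemma dual_normZ (a : R) u : dual_norm (a *: u) = `|a| * dual_norm u.
Proof.
have le_normZ (b : R) w : dual_norm (b *: w) <= `|b| * dual_norm w.
  by apply: dual_norm_le => x x1; rewrite dualZ normrM ler_wpM2l// dual_norm_ge.
apply/eqP; rewrite eq_le le_normZ/=.
have [->|a0] := eqVneq a 0; first by rewrite normr0 mul0r dual_norm_ge0.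
rewrite -ler_pdivlMl ?normr_gt0// -normfV.
by rewrite (le_trans _ (le_normZ _ _))// scalerA mulVf// scale1r.
Qed.

Lemma dual_norm_eq0 u : dual_norm u = 0 -> u = 0.
Proof.
move=> u0; apply: val_inj; apply/funext => x /=; apply/eqP.
by rewrite -normr_le0 (le_trans (dual_normP u x))// u0 mul0r.
Qed.

HB.instance Definition _ := Lmodule_isNormed.Build R (dual_space X)
  dual_normD dual_normZ dual_norm_eq0.

Lemma normr_dualE u : `|u| = dual_norm u. Proof. by []. Qed.

Lemma dual_complete (F : set_system (dual_space X)) :
  ProperFilter F -> cauchy F -> cvg F.
Proof.
move=> FF /cauchy_ballP Fc.
have Fc' e : 0 < e -> \forall u \near F & v \near F, `|u - v| < e.
  by move=> e0; have := Fc e e0; rewrite -ball_normE.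
have cvgx x : cvg ((fun u : dual_space X => u x) @ F).
  apply: R_complete; apply/cauchy_ballP => e e0.
  have e0' : 0 < e / (`|x| + 1) by rewrite divr_gt0// ltr_wpDl.
  rewrite near_map2; apply: filterS (Fc' _ e0') => -[u v] /= uv.
  rewrite -ball_normE /ball_/=.
  rewrite (_ : u x - v x = (u - v) x)//.
  rewrite (le_lt_trans (dual_normP _ _))// -normr_dualE.
  rewrite (@le_lt_trans _ _ (`|u - v| * (`|x| + 1)))//.
    by rewrite ler_wpM2l// lerDl.
  by rewrite -ltr_pdivlMr// ltr_wpDl.
pose l x : R^o := lim ((fun u : dual_space X => u x) @ F).
have cvgl x : (fun u : dual_space X => u x : R^o) @ F --> l x by exact: cvgx.
have ll : linear l.
  move=> a x y; apply/cvg_lim => //.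
  rewrite (_ : (fun u : dual_space X => _) = (fun u : dual_space X => a *: (u x : R^o) + u y)).
    by apply: cvgD => //; apply: cvgZl_tmp.
  by apply/funext => u; rewrite linearP.
have lP (e : R) :
    0 < e -> F [set u : dual_space X | forall x, `|u x - l x| <= e * `|x|].
  move=> e0; have := Fc' _ e0 => /nearP_dep; apply: filterS => u uv x.
  have : (fun v : dual_space X => `|u x - v x|) @ F --> `|u x - l x|.
    by apply: cvg_norm; apply: cvgB => //; exact: cvg_cst.
  move=> /cvg_lim <- //; apply: limr_le.
    apply/cvg_ex; exists `|u x - l x|.
    by apply: cvg_norm; apply: cvgB => //; exact: cvg_cst.
  apply: filterS uv => v uv; rewrite (_ : u x - v x = (u - v) x)//.
  by rewrite (le_trans (dual_normP _ _))// -normr_dualE ler_wpM2r// ltW.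
pose L : {linear X -> R^o} := HB.pack l (GRing.isLinear.Build R X R^o _ l ll).
have cl : continuous l.
  have [u ul] := filter_ex (lP 1 ltr01).
  apply: (@bounded_linear_continuous R X R^o L); apply/bounded_funP => r.
  exists ((dual_norm u + 1) * r) => x xr.
  rewrite -[L x]/(l x) -(subKr (u x) (l x)).
  rewrite (le_trans (ler_normB _ _))//.
  rewrite (@le_trans _ _ ((dual_norm u + 1) * `|x|))//.
    by rewrite mulrDl lerD// dual_normP.
  by rewrite ler_wpM2l// addr_ge0// dual_norm_ge0.
have lin : l \in continuous_linear by rewrite inE.
apply/cvg_ex; exists (Dual lin); apply/cvgrPdist_le => e e0.
apply: filterS (lP _ e0) => u ul; rewrite distrC normr_dualE.
apply: dual_norm_le => x x1; rewrite (le_trans (ul x))//.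
by rewrite ler_piMr// ltW.
Qed.

HB.instance Definition _ := Uniform_isComplete.Build (dual_space X) dual_complete.

End dual_norm.

(* Functions R_+ -> R_+ are represented by total functions [phi : R -> R] whose
   values on the negative reals are irrelevant. *)
Section functions_Rplus.
Context {R : realType}.
Implicit Types phi psi : R -> R.

Definition admissible phi :=
  [/\ forall t : R, 0 <= t -> 0 <= phi t,
      forall s t : R, 0 <= s -> s <= t -> phi s <= phi t,
      phi 0 = 0 &
      forall u : R^nat, (forall n, 0 <= u n) ->
        phi (u n) @[n --> \oo] --> (0 : R) -> u n @[n --> \oo] --> (0 : R)].

Definition strictly_convex_Rplus phi := forall s t a : R,
  0 <= s -> 0 <= t -> s != t -> 0 < a < 1 ->
  phi (a * s + (1 - a) * t) < a * phi s + (1 - a) * phi t.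

(* At 0, differentiability on R_+ can only be one-sided. *)
Definition differentiable_Rplus phi :=
  (forall t : R, 0 < t -> derivable phi t 1) /\
  cvg ((phi s - phi 0) / s @[s --> 0^'+]).

Definition right_derivative phi (t : R) : R :=
  lim ((phi (t + s) - phi t) / s @[s --> 0^'+]).

(* The value at -oo is irrelevant. *)
Definition extend_pinfty psi (d : \bar R) : \bar R :=
  match d with
  | r%:E => (psi r)%:E
  | +oo%E => lim ((psi t)%:E @[t --> +oo])
  | -oo%E => 0%E
  end.

End functions_Rplus.

Section metric_regularity.
Context {R : realType}.
Local Open Scope ereal_scope.

(* [ereal_inf set0 = +oo], so the distance to the empty set is +oo. *)
Definition set_dist {Z : normedModType R} (z : Z) (A : set Z) : \bar R :=
  ereal_inf [set (`|z - a|%R)%:E | a in A].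

Definition minverse {X Y : Type} (F : X -> set Y) (y : Y) : set X :=
  [set x | F x y].

Definition strongly_metrically_regular {X Y : completeNormedModType R}
    (psi : R -> R) (F : X -> set Y) (xbar : X) (ybar : Y) : Prop :=
  F xbar ybar /\
  exists r tau kappa delta : R,
    [/\ (0 < r)%R, (0 < tau)%R, (0 < kappa)%R & (0 < delta)%R] /\
    (forall (x : X) (y : Y), ball xbar r x -> ball ybar r y ->
       extend_pinfty psi (tau%:E * set_dist x (minverse F y))
         <= kappa%:E * set_dist y (F x)) /\
    (forall y : Y, ball ybar r y ->
       exists z, minverse F y `&` ball xbar delta = [set z]).

End metric_regularity.

Section convex_functions.
Context {R : realType} {X : completeNormedModType R}.
Implicit Types f : X -> \bar R.
Local Open Scope ereal_scope.

Definition effective_dom f : set X := [set x | f x < +oo].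

Definition proper_function f := (forall x, f x != -oo) /\ effective_dom f !=set0.

Definition ereal_convex f := forall (x y : X) (a : R), (0 <= a <= 1)%R ->
  f (a *: x + (1 - a) *: y)%R <= a%:E * f x + (1 - a)%:E * f y.

Definition tilt f (u : dual_space X) (x : X) : \bar R := f x - (u x)%:E.

Definition SLWP (phi : R -> R) f (xbar : X) : Prop :=
  exists delta r tau kappa : R,
    [/\ (0 < delta)%R, (0 < r)%R, (0 < tau)%R & (0 < kappa)%R] /\
    exists xu : dual_space X -> X, xu 0%R = xbar /\
      forall u : dual_space X, ball (0%R : dual_space X) delta u ->
        closed_ball xbar r (xu u) /\
        forall x, closed_ball xbar r x ->
          (phi (kappa * `|x - xu u|))%:E
            <= tau%:E * (tilt f u x - tilt f u (xu u)).

Definition subdifferential f (x : X) : set (dual_space X) :=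
  [set u | effective_dom f x /\ forall y, (u (y - x)%R)%:E <= f y - f x].

End convex_functions.

(* Main.v *)
(* Forward: the growth inequality at [xu u] against [xbar] forces
   [xu u -> xbar] as [u -> 0], so [xu u] is an interior local, hence global,
   minimizer of [f - u]. Adding the subgradient inequality for [v] in
   [subdifferential f x] bounds [phi (kappa t) / t] by a multiple of
   [`|u - v|], where [t = `|x - xu u|], and the slope of [phi] on
   [[kappa t / 2, kappa t]] dominates [phi' (kappa t / 2)].
   Backward: for [x] at distance [t] from [xu u], take a functional [h] norming
   [x - xu u], put [v = u + s h] with [s] proportional to [phi' (tau t / 2)],
   and add the subgradient inequalities at [xu u] and at [xu v]:
     f x - f (xu u) - u (x - xu u) >= s (t - `|xu v - xu u|) >= s t / 2,
   as regularity keeps [xu v] within [t / 2] of [xu u]; finally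
   [b phi' b >= phi b]. *)

From HB Require Import structures.
Require Import Defs.
From mathcomp Require Import all_boot all_order all_algebra.
From mathcomp Require Import all_classical all_reals all_analysis.
From mathcomp Require Import ring lra.

Import Order.TTheory GRing.Theory Num.Theory.
Import numFieldNormedType.Exports.

Local Open Scope classical_set_scope.
Local Open Scope ring_scope.

(** * Sublinear functionals and norming functionals, in the manner of Hahn and Banach *)

Definition sublinear {R : realType} {X : lmodType R} (p : X -> R) :=
  (forall x y, p (x + y) <= p x + p y) /\
  (forall a x, 0 < a -> p (a *: x) <= a * p x).

Section sublinear_theory.
Context {R : realType} {X : lmodType R}.
Implicit Types (p q : X -> R) (P : set (X -> R)).

Lemma sublinearZ p (a : R) x : sublinear p -> 0 <= a -> p (a *: x) = a * p x.
Proof.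
move=> [_ pZ]; rewrite le0r => /predU1P[->|a0].
  (* Taking [c = 2] and [c = 2^-1] forces [p 0 = 0]. *)
  have p0 c : 0 < c -> p 0 <= c * p 0 by move=> /(pZ c 0); rewrite scaler0.
  rewrite scale0r mul0r; have := p0 2; have := p0 2^-1; rewrite invr_gt0 ltr0n.
  by move=> /(_ isT) ? /(_ isT) ?; lra.
apply/eqP; rewrite eq_le pZ//= -ler_pdivlMl// -{1}(scalerK (lt0r_neq0 a0) x).
by rewrite pZ// invr_gt0.
Qed.

Lemma sublinear_geN p x : sublinear p -> - p (- x) <= p x.
Proof.
move=> sp; have := sp.1 x (- x); rewrite subrr.
by rewrite -(scale0r 0) sublinearZ// mul0r -lerBlDr sub0r.
Qed.

(** The two closure conditions only ask for domination by some member of [P]. This covers chains,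
    where the smaller function serves, as well as the one-parameter families used for lowering along
    a direction. *)
Lemma sublinear_inf P : P !=set0 ->
  (forall x, has_lbound [set g x | g in P]) ->
  (forall g1 g2 x1 x2, P g1 -> P g2 ->
    exists2 g, P g & g (x1 + x2) <= g1 x1 + g2 x2) ->
  (forall g a x, P g -> 0 < a -> exists2 g', P g' & g' (a *: x) <= a * g x) ->
  sublinear (fun x => inf [set g x | g in P]).
Proof.
move=> [g0 Pg0] Pb PD PZ.
have ne x : [set g x | g in P] !=set0 by exists (g0 x), g0.
split=> [x y|a x a0].
  rewrite -lerBlDr; apply: lb_le_inf => // _ [g1 Pg1 <-].
  rewrite lerBlDr -lerBlDl; apply: lb_le_inf => // _ [g2 Pg2 <-].
  rewrite lerBlDl; have [g Pg] := PD _ _ x y Pg1 Pg2.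
  by apply: le_trans; apply: ge_inf => //; exists g.
rewrite -ler_pdivrMl//; apply: lb_le_inf => // _ [g Pg <-].
rewrite ler_pdivrMl//; have [g' Pg'] := PZ g a x Pg a0.
by apply: le_trans; apply: ge_inf => //; exists g'.
Qed.

(** Zorn's lemma: the pointwise infimum of a nonempty chain is again sublinear and below [q]. *)
Lemma minimal_sublinear q : sublinear q -> exists p,
  [/\ sublinear p, forall x, p x <= q x &
      forall p', sublinear p' -> (forall x, p' x <= p x) ->
        forall x, p x <= p' x].
Proof.
move=> sq; pose below p := sublinear p /\ forall x, p x <= q x.
pose T := {p | below p}.
pose t0 : T := exist below q (conj sq (fun x => lexx (q x))).
(* The order is reversed, so that a maximal element is a minimal function. *)
pose Rel (s t : T) := `[< forall x, sval t x <= sval s x >].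
have [||A Atot|[p [sp pq]] pmin] := @ZL_preorder T t0 Rel.
- by move=> t; apply/asboolP.
- move=> r s t /asboolP rs /asboolP st; apply/asboolP => x.
  exact: le_trans (st x) (rs x).
- have [[a0 Aa0]|A0] := pselect (A !=set0); last first.
    by exists t0 => s As; exfalso; apply: A0; exists s.
  pose P := [set sval a | a in A].
  have Pb x : has_lbound [set g x | g in P].
    (* The infimum is finite because [- q (- x) <= - g (- x) <= g x]. *)
    exists (- q (- x)) => _ [_ [[g [sg gq]] _ <-] <-] /=.
    by rewrite (le_trans _ (sublinear_geN _ x sg))// lerN2 gq.
  have sP : sublinear (fun x => inf [set g x | g in P]).
    apply: sublinear_inf => //; first by exists (sval a0), a0.
    + move=> _ _ x y [g1 Ag1 <-] [g2 Ag2 <-].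
      have [/asboolP g21|/asboolP g12] := Atot _ _ Ag1 Ag2.
        exists (sval g2); first by exists g2.
        by rewrite (le_trans ((svalP g2).1.1 x y))// lerD2r.
      exists (sval g1); first by exists g1.
      by rewrite (le_trans ((svalP g1).1.1 x y))// lerD2l.
    + move=> _ a x [g Ag <-] a0'; exists (sval g); first by exists g.
      exact: (svalP g).1.2.
  have Pq x : inf [set g x | g in P] <= q x.
    rewrite (le_trans _ ((svalP a0).2 x))//; apply: ge_inf => //.
    by exists (sval a0) => //; exists a0.
  exists (exist below _ (conj sP Pq)) => s As; apply/asboolP => x /=.
  by apply: ge_inf => //; exists (sval s) => //; exists s.
exists p; split=> // p' sp' p'p x.
have p'q y : p' y <= q y by exact: le_trans (p'p y) (pq y).
have /asboolP := pmin (exist below p' (conj sp' p'q)) (introT (asboolP _) p'p).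
exact.
Qed.

(* q x = inf over t >= 0 of p (x + t y) - t p y. *)
Lemma directional_sublinear p y : sublinear p -> exists q,
  [/\ sublinear q, forall x, q x <= p x & forall x, q x <= p (x + y) - p y].
Proof.
move=> sp; pose G t x := p (x + t *: y) - t * p y.
pose P := [set G t | t in [set t | 0 <= t]].
have Pb x : has_lbound [set g x | g in P].
  (* Subadditivity gives [t * p y = p (t *: y) <= p (x + t *: y) + p (- x)]. *)
  exists (- p (- x)) => _ [_ [t /= t0 <-] <-]; rewrite /G.
  have := sp.1 (x + t *: y) (- x); rewrite addrAC subrr add0r sublinearZ//.
  lra.
exists (fun x => inf [set g x | g in P]); split.
- apply: sublinear_inf => //; first by exists (G 0), 0 => /=.
  + move=> _ _ x1 x2 [s /= s0 <-] [t /= t0 <-].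
    exists (G (s + t)); first by exists (s + t) => //=; exact: addr_ge0.
    have := sp.1 (x1 + s *: y) (x2 + t *: y).
    by rewrite /G addrACA -scalerDl; lra.
  + move=> _ a x [t /= t0 <-] a0; exists (G (a * t)).
    by exists (a * t) => //=; rewrite mulr_ge0// ltW.
  by rewrite /G -scalerA -scalerDr sublinearZ ?(ltW a0)// mulrBr mulrA lexx.
- move=> x; apply: ge_inf => //; exists (G 0); first by exists 0 => /=.
  by rewrite /G scale0r addr0 mul0r subr0.
- move=> x; apply: ge_inf => //; exists (G 1); first by exists 1 => /=.
  by rewrite /G scale1r mul1r.
Qed.

(* A minimal sublinear function is additive, since it cannot be lowered along
   any direction [y] by [directional_sublinear]. *)
Lemma linear_below_sublinear p : sublinear p ->
  exists2 l : X -> R^o, linear l & forall x, l x <= p x.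
Proof.
move=> /minimal_sublinear[l [sl lp lmin]]; exists l => //.
have lD x y : l (x + y) = l x + l y.
  apply/eqP; rewrite eq_le sl.1/= -lerBrDr.
  have [q [sq ql qy]] := directional_sublinear _ y sl.
  exact: le_trans (lmin q sq ql x) (qy x).
have l0 : l 0 = 0 by rewrite -(scale0r 0) sublinearZ// mul0r.
have lN x : l (- x) = - l x.
  by apply/eqP; rewrite -addr_eq0 -lD addNr l0.
move=> a x y; rewrite lD; congr (_ + _).
have [a0|a0] := leP 0 a; first by rewrite sublinearZ.
have := sublinearZ l (- a) x sl; rewrite oppr_ge0 => /(_ (ltW a0)).
by rewrite scaleNr lN mulNr => /oppr_inj.
Qed.

End sublinear_theory.

(** Lowering the norm along [x0] gives a sublinear [q] with [q (- x0) <= - |x0|]. A linear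
    functional below [q] is then bounded by the norm and at least [|x0|] at [x0]. *)
Lemma norming_functional (R : realType) (X : normedModType R) (x0 : X) :
  exists2 h : dual_space X, `|h| <= 1 & h x0 = `|x0|.
Proof.
have sn : sublinear (fun x : X => `|x|).
  by split=> [x y|a x a0]; [exact: ler_normD|rewrite normrZ gtr0_norm].
have [q [sq qn qx0]] := directional_sublinear _ x0 sn.
have [l ll lq] := linear_below_sublinear _ sq.
pose L : {linear X -> R^o} := HB.pack l (GRing.isLinear.Build R X R^o _ l ll).
have lN x : l (- x) = - l x by exact: (linearN L).
have l1 x : `|l x| <= `|x|.
  by rewrite ler_norml lerNl -lN -{1}normrN !(le_trans (lq _)).
have cl : continuous l.
  apply: (@bounded_linear_continuous R X R^o L); apply/bounded_funP => r.
  by exists r => x xr; exact: le_trans (l1 x) xr.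
have lP : l \in continuous_linear by rewrite inE.
exists (Dual lP).
  rewrite normr_dualE; apply: dual_norm_le => x x1.
  exact: le_trans (l1 x) x1.
apply/eqP; rewrite eq_le/= (le_trans (ler_norm _))//=.
have := le_trans (lq (- x0)) (qx0 _); rewrite lN addNr normr0; lra.
Qed.

(** * Slopes and right derivatives of a convex function *)

Section right_derivative_convex.
Context {R : realType} (phi : R -> R).
Context (phi_convex : strictly_convex_Rplus phi).
Context (phi_diff : differentiable_Rplus phi).

(** Convexity applies because [a + s] is the combination of [a + h] and [a] with weight [s / h]. *)
Lemma right_slope_le a s h : 0 <= a -> 0 < s -> s <= h ->
  (phi (a + s) - phi a) / s <= (phi (a + h) - phi a) / h.
Proof.
move=> a0 s0; rewrite le_eqVlt => /predU1P[->//|sh].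
have h0 : 0 < h by exact: lt_trans sh.
have ah : a + h != a by rewrite -subr_eq0 addrAC subrr add0r lt0r_neq0.
have sh1 : 0 < s / h < 1 by rewrite divr_gt0//= ltr_pdivrMr// mul1r.
have := phi_convex _ _ _ (addr_ge0 a0 (ltW h0)) a0 ah sh1.
rewrite (_ : s / h * (a + h) + _ = a + s); last by field; rewrite lt0r_neq0.
move=> /ltW conv; rewrite ler_pdivrMr//.
have -> : (phi (a + h) - phi a) / h * s = s / h * (phi (a + h) - phi a) by ring.
lra.
Qed.

Lemma cvg_right_slope a : 0 <= a ->
  cvg ((phi (a + s) - phi a) / s @[s --> 0^'+]).
Proof.
rewrite le_eqVlt => /predU1P[<-|a0].
  by rewrite (_ : (fun s => _) = (fun s => (phi s - phi 0) / s));
    [exact: phi_diff.2|apply/funext => s; rewrite add0r].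
have /cvg_ex[l /cvg_dnbhs_at_right al] := phi_diff.1 _ a0.
apply/cvg_ex; exists l; rewrite (_ : (fun s => _) =
  (fun h => h^-1 *: (phi (h *: 1 + a) - phi a)))//.
by apply/funext => s; rewrite [_ *: 1]mulr1 [RHS]mulrC (addrC s).
Qed.

Lemma right_derivative_le_slope a h : 0 <= a -> 0 < h ->
  right_derivative phi a <= (phi (a + h) - phi a) / h.
Proof.
move=> a0 h0; apply: limr_le; first exact: cvg_right_slope.
near=> s; apply: right_slope_le => //.
by near: s; exact: nbhs_right_le.
Unshelve. all: by end_near. Qed.

(** Since [b] lies between [0] and [b + s], the slope on [[0, b]] is at most each slope on
    [[b, b + s]]; let [s] tend to 0. *)
Lemma slope_le_right_derivative b : 0 < b ->
  (phi b - phi 0) / b <= right_derivative phi b.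
Proof.
move=> b0; apply: limr_ge; first by apply: cvg_right_slope; exact: ltW.
near=> s; have s0 : 0 < s by near: s; exact: nbhs_right_gt.
have bs0 : 0 < b + s by exact: addr_gt0.
have b1 : 0 < b / (b + s) < 1 by rewrite divr_gt0//= ltr_pdivrMr// mul1r ltrDl.
have := phi_convex _ _ _ (ltW bs0) (lexx 0) (lt0r_neq0 bs0) b1.
rewrite mulr0 addr0 divfK ?lt0r_neq0// => /ltW conv.
have conv' : phi b * (b + s) <= b * phi (b + s) + s * phi 0.
  rewrite -ler_pdivlMr// (le_trans conv)// le_eqVlt; apply/orP; left.
  by apply/eqP; field; rewrite lt0r_neq0.
rewrite ler_pdivrMr// mulrAC ler_pdivlMr//; nra.
Unshelve. all: by end_near. Qed.

End right_derivative_convex.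

(** If [psi t = 0], the constant sequence [t] violates the limit condition of admissibility. *)
Lemma admissible_gt0 (R : realType) (psi : R -> R) t :
  admissible psi -> 0 < t -> 0 < psi t.
Proof.
move=> [psi0 _ _ psi_lim] t0; rewrite lt0r psi0 ?ltW// andbT.
apply/eqP => pt0; have : (fun=> t) @ \oo --> (0 : R).
  by apply: psi_lim => [_|]; [exact: ltW|rewrite pt0; exact: cvg_cst].
move=> /(cvg_lim (@Rhausdorff R)); rewrite lim_cst; last exact: Rhausdorff.
by move=> t_eq0; rewrite t_eq0 ltxx in t0.
Qed.

Lemma dual_scaleE (R : realType) (X : normedModType R) (u : dual_space X)
  (c : R) x : u (c *: x) = c * u x.
Proof. exact: linearZ. Qed.

(** * Subgradients of convex functions: from local to global *)

Section convex_subdifferential.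
Context {R : realType} {X : completeNormedModType R} (f : X -> \bar R).
Context (f_proper : proper_function f).
Context (f_convex : ereal_convex f).

Lemma effective_domP x : effective_dom f x -> {a : R | f x = a%:E}.
Proof.
move=> fx; exists (fine (f x)); rewrite fineK// fin_numE f_proper.1/=.
by rewrite -ltey.
Qed.

Lemma subdifferentialP x a u : f x = a%:E ->
  subdifferential f x u <-> forall y, ((a + u (y - x))%:E <= f y)%E.
Proof.
move=> fx; rewrite /subdifferential/= /effective_dom/= fx; split.
  by move=> [_ +] y => /(_ y); rewrite leeBrDr// -EFinD addrC.
move=> au; split; first exact: ltry.
by move=> y; rewrite leeBrDr// -EFinD addrC.
Qed.

Lemma ereal_convex_le x y a b c : f x = a%:E -> f y = b%:E -> 0 <= c <= 1 ->
  (f (y + c *: (x - y))%R <= (b + c * (a - b))%:E)%E.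
Proof.
move=> fx fy c01; have := f_convex x y c c01; rewrite fx fy -!EFinM -EFinD.
rewrite (_ : _ *: x + _ = y + c *: (x - y)); last first.
  by rewrite scalerBr scalerBl scale1r; rewrite addrCA.
by rewrite (_ : c * a + _ = b + c * (a - b)); last ring.
Qed.

(** Puts the growth condition in the same form as a subgradient inequality, an affine lower bound on
    [f] plus a remainder, with no extended-real subtraction left. *)
Lemma tilt_growthE (u : dual_space X) x z m c tau : f z = m%:E -> 0 < tau ->
  (c%:E <= tau%:E * (tilt f u x - tilt f u z))%E =
  ((m + u (x - z) + c / tau)%:E <= f x)%E.
Proof.
move=> fz tau0; rewrite /tilt fz linearB -EFinB; have := f_proper.1 x.
case: (f x) => [a _| _ |//]; last first.
  by rewrite [X in (_ * X)%E](_ : _ = +oo%E)// gt0_muley ?lte_fin// !leey.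
rewrite -!EFinB -EFinM !lee_fin -lerBrDl ler_pdivrMr// [leRHS]mulrC.
by congr (_ <= _ * _); ring.
Qed.

(** If [f z] were [+oo], the right-hand side would be [-oo], below [c]. *)
Lemma tilt_ge_effective_dom (u : dual_space X) x z c tau :
  effective_dom f x -> 0 <= c -> 0 < tau ->
  (c%:E <= tau%:E * (tilt f u x - tilt f u z))%E -> effective_dom f z.
Proof.
move=> /effective_domP[a fx] c0 tau0; rewrite /tilt fx /effective_dom/=.
case: (f z) (f_proper.1 z) => [m _ _|_|//]; first exact: ltry.
by rewrite [X in (_ * X)%E](_ : _ = -oo%E)// gt0_muleNy ?lte_fin.
Qed.

Lemma ball_segment (z y : X) (e : R) : 0 < e ->
  exists2 c : R, 0 < c <= 1 & ball z e (z + c *: (y - z)).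
Proof.
(* The added 1 keeps [d] positive when [y = z]. *)
move=> e0; pose d := `|y - z| + 1; have d0 : 0 < d by rewrite ltr_wpDl.
exists (Num.min 1 (e / d)).
  by rewrite lt_min ltr01 divr_gt0//= ge_min lexx.
rewrite -ball_normE /ball_/= opprD addNKr normrN normrZ ger0_norm; last first.
  by rewrite le_min ler01 divr_ge0// ltW.
rewrite (@le_lt_trans _ _ (e / d * `|y - z|))//.
  by rewrite ler_wpM2r// ge_min lexx orbT.
by rewrite mulrAC ltr_pdivrMr// ltr_pM2l// ltrDl.
Qed.

(** Apply the local bound at a point [z + c *: (y - z)] of the ball, bound [f] there by convexity,
    and cancel [c]. *)
Lemma subdifferential_local (u : dual_space X) z m e : f z = m%:E -> 0 < e ->
  (forall x, ball z e x -> ((m + u (x - z))%:E <= f x)%E) ->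
  subdifferential f z u.
Proof.
move=> fz e0 loc; apply/(subdifferentialP _ _ _ fz) => y.
have [fyoo|/effective_domP[b fy]] : f y = +oo%E \/ effective_dom f y.
- by rewrite /effective_dom/= ltey; have [->|] := eqVneq (f y) +oo%E;
    [left|right].
- by rewrite fyoo leey.
have [c /andP[c0 c1] /loc] := ball_segment z y _ e0.
have c01 : 0 <= c <= 1 by rewrite ltW.
move=> /le_trans/(_ (ereal_convex_le _ _ _ _ _ fy fz c01)).
rewrite addrAC subrr add0r dual_scaleE fy !lee_fin => h.
have : c * u (y - z) <= c * (b - m) by move: h; rewrite lerD2l.
by rewrite ler_pM2l// lerBrDl.
Qed.

(** Upgrades local uniqueness to global uniqueness: if [u] is a subgradient at [z] and at [y], it is
    one along the segment joining them, which has points other than [z] in the ball unless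
    [y = z]. *)
Lemma minverse_subdifferential_unique (u : dual_space X) z xbar e :
  minverse (subdifferential f) u `&` ball xbar e = [set z] ->
  minverse (subdifferential f) u = [set z].
Proof.
move=> zE.
have [uz ez] : (minverse (subdifferential f) u `&` ball xbar e) z by rewrite zE.
apply/seteqP; split=> [y uy|_ ->//].
have [a fy] := effective_domP _ uy.1; have [m fz] := effective_domP _ uz.1.
have e'0 : 0 < e - `|xbar - z|.
  by rewrite subr_gt0; move: ez; rewrite -ball_normE.
have [c /andP[c0 c1] zc] := ball_segment z y _ e'0.
have c01 : 0 <= c <= 1 by rewrite ltW.
suff : [set z] (z + c *: (y - z)).
  move=> /= /eqP; rewrite -subr_eq0 addrAC subrr add0r scaler_eq0 gt_eqF//=.
  by rewrite subr_eq0 => /eqP.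
rewrite -zE; split; last first.
  move: zc; rewrite -!ball_normE/= => zc.
  have := ler_normD (xbar - z) (z - (z + c *: (y - z))).
  by rewrite addrA subrK; lra.
(* The subgradient inequality at [y], tested at [z]. *)
have am : a <= m + u (y - z).
  have /(_ z) := (subdifferentialP _ _ _ fy).1 uy.
  by rewrite fz lee_fin -opprB linearN/=; lra.
have wle := ereal_convex_le _ _ _ _ _ fy fz c01.
have [w fw] := effective_domP _ (le_lt_trans wle (ltry _)).
apply/(subdifferentialP _ _ _ fw) => x.
(* As [w <= m + c * u (y - z)], the affine function of slope [u] through the new point lies below
   the one through [z], hence below [f]. *)
have /(_ x) := (subdifferentialP _ _ _ fz).1 uz; apply: le_trans.
move: wle; rewrite fw !lee_fin => wle.
rewrite opprD addrA linearB/= dual_scaleE.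
have : c * (a - m) <= c * u (y - z) by rewrite ler_pM2l//; lra.
lra.
Qed.

End convex_subdifferential.

(** * Estimates for the distance to a set *)

Section set_dist_bounds.
Context {R : realType} {Z : normedModType R}.
Implicit Types (z a : Z) (A : set Z).

(** A member of [A] makes the distance finite, so [extend_pinfty] takes its real branch. *)
Lemma set_dist_le z a A : A a ->
  exists2 d : R, set_dist z A = d%:E & 0 <= d <= `|z - a|.
Proof.
move=> Aa; have le_a : (set_dist z A <= `|z - a|%:E)%E.
  by apply: ereal_inf_lbound; exists a.
have ge0 : (0%:E <= set_dist z A)%E.
  by apply: le_ereal_inf_tmp => _ [b _ <-]; rewrite lee_fin.
move: le_a ge0; case: (set_dist z A) => [d| |] //.
by rewrite !lee_fin => da d0; exists d => //; rewrite d0 da.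
Qed.

Lemma set_dist1 z a : set_dist z [set a] = `|z - a|%:E.
Proof. by rewrite /set_dist image_set1 ereal_inf1. Qed.

(** Includes the empty [A], at distance [+oo], so points without subgradients need no separate
    case. *)
Lemma le_mul_set_dist z A (c k : R) : 0 < k ->
  (forall a, A a -> c <= k * `|z - a|) -> (c%:E <= k%:E * set_dist z A)%E.
Proof.
move=> k0 H; rewrite -lee_pdivrMl//; apply: le_ereal_inf_tmp => _ [a Aa <-].
by rewrite -EFinM lee_fin ler_pdivrMl// H.
Qed.

Lemma ball0P z (r : R) : ball 0 r z <-> `|z| < r.
Proof. by rewrite -ball_normE /ball_/= sub0r normrN. Qed.

End set_dist_bounds.

(** * The two implications between well-posedness and regularity *)

Section local_well_posedness.
Context {R : realType} {X : completeNormedModType R}.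
Context (phi : R -> R) (f : X -> \bar R) (xbar : X).
Context (phi_admissible : admissible phi).
Context (phi_convex : strictly_convex_Rplus phi).
Context (phi_diff : differentiable_Rplus phi).
Context (dphi_admissible : admissible (right_derivative phi)).
Context (f_proper : proper_function f).
Context (f_convex : ereal_convex f).
Context (xbar_dom : effective_dom f xbar).

Let phi_ge0 := let: And4 h _ _ _ := phi_admissible in h.
Let phi_le := let: And4 _ h _ _ := phi_admissible in h.
Let phi0 := let: And4 _ _ h _ := phi_admissible in h.
Let dphi_le := let: And4 _ h _ _ := dphi_admissible in h.
Let dphi0 := let: And4 _ _ h _ := dphi_admissible in h.

Lemma SLWP_regular : SLWP phi f xbar ->
  strongly_metrically_regular (right_derivative phi) (subdifferential f)
    xbar (0 : dual_space X).
Proof.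
move=> [delta [r [tau [kap [[delta0 r0 tau0 kap0] [xu [xu0 slwp]]]]]]].
have cballP x : closed_ball xbar r x <-> `|xbar - x| <= r.
  by rewrite closed_ballE.
have growth (u : dual_space X) : ball 0 delta u -> exists2 m, f (xu u) = m%:E &
    forall x, `|xbar - x| <= r ->
      ((m + u (x - xu u) + phi (kap * `|x - xu u|) / tau)%:E <= f x)%E.
  move=> /slwp[_ {}slwp].
  have xbar_in : closed_ball xbar r xbar by exact: closed_ballxx.
  have phi_ge x : 0 <= phi (kap * `|x - xu u|).
    by rewrite phi_ge0// mulr_ge0// ltW.
  have /(effective_domP _ f_proper)[m fm] := tilt_ge_effective_dom _
    f_proper _ _ _ _ _ xbar_dom (phi_ge _) tau0 (slwp _ xbar_in).
  exists m => // x /cballP /slwp.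
  by rewrite (tilt_growthE _ f_proper _ _ _ _ _ _ fm tau0).
have [m0 fm0] := effective_domP _ f_proper _ xbar_dom.
(* Growth will give [phi (kap * |xbar - xu u|) <= tau * |u| * r]; for [|u| < d] this is below
   [phi (kap * (r / 2))], which forces [xu u] within [r / 2] of [xbar]. *)
pose d := Num.min delta (phi (kap * (r / 2)) / (tau * r)).
have d0 : 0 < d.
  by rewrite lt_min delta0 divr_gt0 ?mulr_gt0// admissible_gt0// !mulr_gt0.
have d_delta (u : dual_space X) : ball 0 d u -> ball 0 delta u.
  by apply: le_ball; rewrite ge_min lexx.
have xu_near (u : dual_space X) : ball 0 d u -> `|xbar - xu u| < r / 2.
  move=> ud; have [/cballP xur _] := slwp _ (d_delta _ ud).
  have [m fm gm] := growth _ (d_delta _ ud).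
  have := gm xbar; rewrite subrr normr0 fm0 lee_fin => /(_ (ltW r0)) gm0.
  (* Growth for the zero functional, tested at [xu u], gives [m0 <= m]. *)
  have [m0' + g0] := growth 0 (ballxx _ delta0).
  rewrite xu0 fm0 => -[m0'E]; have := g0 _ xur.
  rewrite fm lee_fin -m0'E xu0 => gm1.
  have p0 : 0 <= phi (kap * `|xu u - xbar|) / tau.
    by rewrite divr_ge0 ?phi_ge0 ?mulr_ge0// ltW.
  have m0m : m0 <= m.
    by move: gm1; rewrite (_ : (0 : dual_space X) _ = 0)//; lra.
  have phi_u : phi (kap * `|xbar - xu u|) / tau <= `|u| * r.
    have := dual_normP u (xbar - xu u); rewrite -normr_dualE ler_norml.
    have := ler_wpM2l (normr_ge0 u) xur; lra.
  rewrite ltNge; apply/negP => far.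
  have : phi (kap * (r / 2)) <= phi (kap * `|xbar - xu u|).
    by apply: phi_le; [rewrite !mulr_ge0// ltW|rewrite ler_pM2l].
  move: ud => /ball0P; rewrite lt_min ltr_pdivlMr ?mulr_gt0// => /andP[_].
  move: phi_u; rewrite ler_pdivrMr//; lra.
have xu_sub (u : dual_space X) : ball 0 d u -> subdifferential f (xu u) u.
  move=> ud; have [m fm gm] := growth _ (d_delta _ ud).
  have r20 : 0 < r / 2 by rewrite divr_gt0.
  apply: (subdifferential_local _ f_proper f_convex _ _ _ _ fm r20) => x.
  rewrite -ball_normE /ball_/= => xx; apply: le_trans (gm _ _); last first.
    by have := ler_distD (xu u) xbar x; have := xu_near _ ud; lra.
  by rewrite lee_fin lerDl divr_ge0 ?phi_ge0 ?mulr_ge0// ltW.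
have sub_growth (u v : dual_space X) x : ball 0 d u -> ball xbar r x ->
    subdifferential f x v ->
    phi (kap * `|x - xu u|) / tau <= `|u - v| * `|x - xu u|.
  move=> ud; rewrite -ball_normE /ball_/= => /ltW xr xv.
  have [m fm gm] := growth _ (d_delta _ ud).
  have [a fa] := effective_domP _ f_proper _ xv.1.
  have := gm _ xr; rewrite fa lee_fin => gx.
  have /(_ (xu u)) := (subdifferentialP _ _ _ _ fa).1 xv.
  rewrite fm lee_fin -opprB linearN => va.
  have := dual_normP (u - v) (x - xu u); rewrite -normr_dualE ler_norml.
  have -> : (u - v) (x - xu u) = u (x - xu u) - v (x - xu u) :> R by [].
  move: va gx; rewrite [- v _]/(- v _ : R); lra.
split; first by rewrite -xu0; apply: xu_sub; exact: ballxx.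
(* With [h = kap / 2 * t], the slope bound on [[h, 2 * h]] gives [phi' h * h <= phi (kap * t) <= tau
   * |u - v| * t]; dividing by [h] yields the factor [2 * tau / kap]. *)
exists (Num.min r d), (kap / 2), (2 * tau / kap), (r / 2).
split; first by rewrite lt_min r0 d0 !divr_gt0 ?mulr_gt0.
split=> [x u xr ur|u ur].
  have {}xr : ball xbar r x by move: xr; apply: le_ball; rewrite ge_min lexx.
  have {}ur : ball 0 d u.
    by move: ur; apply: le_ball; rewrite ge_min lexx orbT.
  have [e -> /andP[e0 ex]] := set_dist_le x (xu u)
    (minverse (subdifferential f) u) (xu_sub _ ur).
  apply: le_mul_set_dist => [|v xv]; first by rewrite divr_gt0 ?mulr_gt0.
  apply: (@le_trans _ _ (right_derivative phi (kap / 2 * `|x - xu u|))).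
    apply: dphi_le; first by rewrite !mulr_ge0 ?invr_ge0// ltW.
    by rewrite ler_pM2l ?divr_gt0.
  have := sub_growth _ _ _ ur xr xv.
  have [->|] := eqVneq `|x - xu u| 0.
    by move=> _; rewrite mulr0 dphi0 !mulr_ge0 ?invr_ge0 ?mulr_ge0// ltW.
  move: (normr_ge0 (x - xu u)); set t := `|x - xu u| => t0 tn0.
  have {tn0}t0 : 0 < t by rewrite lt0r tn0.
  have h0 : 0 < kap / 2 * t by rewrite !mulr_gt0// invr_gt0.
  have := right_derivative_le_slope _ phi_convex phi_diff _ _ (ltW h0) h0.
  have -> : kap / 2 * t + kap / 2 * t = kap * t by field.
  rewrite ler_pdivlMr// ler_pdivrMr// => slope gr.
  have := phi_ge0 _ (ltW h0) => phi_h.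
  rewrite -(ler_pM2r h0); apply: (le_trans slope).
  have -> : 2 * tau / kap * `|u - v| * (kap / 2 * t) = `|u - v| * t * tau.
    by field; rewrite lt0r_neq0.
  lra.
have {}ur : ball 0 d u by move: ur; apply: le_ball; rewrite ge_min lexx orbT.
exists (xu u); apply/seteqP; split=> [z [uz]|_ ->]; last first.
  by split; [exact: xu_sub|rewrite -ball_normE; exact: xu_near].
move=> zr; have {}zr : ball xbar r z.
  by move: zr; apply: le_ball; rewrite ler_pdivrMr// ler_pMr//; lra.
(* With [v = u] the right-hand side vanishes, so [phi] vanishes at [kap * |z - xu u|]. *)
have := sub_growth _ _ _ ur zr uz.
rewrite subrr normr0 mul0r ler_pdivrMr// mul0r => phi_le0.
apply/eqP; rewrite -subr_eq0 -normr_le0 leNgt; apply/negP => zxu.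
by move: phi_le0; rewrite leNgt admissible_gt0// mulr_gt0.
Qed.

Lemma regular_SLWP :
  strongly_metrically_regular (right_derivative phi) (subdifferential f)
    xbar (0 : dual_space X) -> SLWP phi f xbar.
Proof.
move=> [xbar0 [r [tau [kap [delta [[r0 tau0 kap0 delta0] [reg single]]]]]]].
(* The default [xbar] is taken only where [u] has an empty preimage, which does not happen for
   [|u| < r]. *)
pose xu u := xget xbar (minverse (subdifferential f) u).
have xuE (u : dual_space X) : ball 0 r u ->
    minverse (subdifferential f) u = [set xu u].
  move=> /single[z].
  move=> /(minverse_subdifferential_unique _ f_proper f_convex) zE.
  rewrite /xu zE; congr [set _]; apply/esym.
  by have : [set z] (xget xbar [set z]) by apply: xgetPex; exists z.
have xu0 : xu 0 = xbar.
  have : minverse (subdifferential f) 0 xbar by [].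
  by rewrite xuE; [move=> ->|exact: ballxx].
have xu_sub (u : dual_space X) : ball 0 r u -> subdifferential f (xu u) u.
  move=> ur; suff : minverse (subdifferential f) u (xu u) by [].
  by rewrite xuE.
have lip x (u v : dual_space X) :
    ball xbar r x -> ball 0 r u -> subdifferential f x v ->
    right_derivative phi (tau * `|x - xu u|) <= kap * `|u - v|.
  move=> xr ur xv; have := reg _ _ xr ur.
  rewrite xuE// set_dist1 -EFinM /= => /le_trans; rewrite -lee_fin; apply.
  rewrite EFinM lee_wpmul2l ?lee_fin ?(ltW kap0)//.
  by apply: ereal_inf_lbound; exists v.
have dphi_lt s t : 0 <= t -> right_derivative phi (tau * s) <
    right_derivative phi (tau * t) -> s < t.
  move=> t0; apply: contraTT; rewrite -!leNgt => ts.
  by apply: dphi_le; [rewrite mulr_ge0// ltW|rewrite ler_pM2l].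
have dphir0 : 0 < right_derivative phi (tau * r).
  by rewrite admissible_gt0// mulr_gt0.
(* Halved so that [u + s *: h] has norm below [2 * S] when [|u| < S] and [s <= S]. The bound
   [2 * S <= r] keeps it in the regularity ball, and the other bound puts its [xu] within [r] of
   [xbar]. *)
pose S := Num.min r (right_derivative phi (tau * r) / kap) / 2.
have S0 : 0 < S by rewrite divr_gt0// lt_min r0 divr_gt0.
have S_r (u : dual_space X) : `|u| < 2 * S -> ball 0 r u.
  rewrite /S mulrC divfK ?pnatr_eq0// => uS; apply/ball0P.
  by rewrite (lt_le_trans uS)// ge_min lexx.
have xu_near (u : dual_space X) : `|u| < 2 * S -> ball xbar r (xu u).
  move=> uS; have := lip xbar u 0 (ballxx _ r0) (S_r _ uS) xbar0.
  rewrite subr0 -ball_normE => /le_lt_trans lt_u; apply: dphi_lt (ltW r0) _.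
  apply: lt_u; move: uS; rewrite /S mulrC divfK ?pnatr_eq0// lt_min.
  by rewrite ltr_pdivlMr// mulrC => /andP[].
(* The first term makes [kap * s] at most half of [phi' (tau * (t / 2))], so that [xu v] is strictly
   within [t / 2] of [xu u]; the second ensures [s <= S], since [t / 2 <= r]. *)
pose c := Num.min (2 * kap)^-1 (S / right_derivative phi (tau * r)).
have c0 : 0 < c by rewrite lt_min invr_gt0 mulr_gt0//= divr_gt0.
(* With [b = tau / 2 * t], the gain [s * (t / 2)] equals [(c / tau) * (b * phi' b)], hence is at
   least [phi b / (tau / c)]. *)
exists S, r, (tau / c), (tau / 2).
split; first by split=> //; rewrite divr_gt0.
exists xu; split=> // u /ball0P uS.
have uS2 : `|u| < 2 * S by lra.
have ur := S_r _ uS2.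
have xur : `|xbar - xu u| < r by have := xu_near _ uS2; rewrite -ball_normE.
split=> [|x]; first by rewrite closed_ballE//; exact: ltW.
rewrite closed_ballE// /closed_ball_/= => xr.
have [m fm] := effective_domP _ f_proper _ (xu_sub _ ur).1.
rewrite (tilt_growthE _ f_proper _ _ _ _ _ _ fm) ?divr_gt0//.
have [->|xxu] := eqVneq x (xu u).
  by rewrite subrr normr0 linear0 mulr0 phi0 mul0r !addr0 fm.
have [h h1] := norming_functional _ _ (x - xu u).
have : 0 < `|x - xu u| by rewrite normr_gt0 subr_eq0.
have : `|x - xu u| <= 2 * r.
  by have := ler_distD xbar x (xu u); rewrite (distrC x xbar); lra.
set t := `|x - xu u| => t2r t0 ht.
have dphit0 : 0 < right_derivative phi (tau * (t / 2)).
  by rewrite admissible_gt0// !mulr_gt0// invr_gt0.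
pose s := c * right_derivative phi (tau * (t / 2)).
have s0 : 0 < s by exact: mulr_gt0.
have sS : s <= S.
  rewrite (@le_trans _ _ (c * right_derivative phi (tau * r)))//.
    rewrite ler_pM2l// dphi_le//; first by rewrite !mulr_ge0 ?invr_ge0// ltW.
    by rewrite ler_pM2l// ler_pdivrMr// mulrC.
  by rewrite -ler_pdivlMr// ge_min lexx orbT.
have ks : kap * s <= right_derivative phi (tau * (t / 2)) / 2.
  rewrite /s mulrA [leRHS]mulrC ler_pM2r// mulrC -ler_pdivlMr//.
  by rewrite -invfM ge_min lexx.
pose v := u + s *: h.
have sh : `|s *: h| <= s by rewrite normrZ gtr0_norm// ler_piMr// ltW.
have vS : `|v| < 2 * S by have := ler_normD u (s *: h); rewrite -/v; lra.
have vsub := xu_sub _ (S_r _ vS).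
have [b fb] := effective_domP _ f_proper _ vsub.1.
have xuv : `|xu v - xu u| < t / 2.
  apply: dphi_lt; first by rewrite divr_ge0// ltW.
  have := lip _ _ _ (xu_near _ vS) ur vsub.
  rewrite /v opprD addNKr normrN.
  have := ler_wpM2l (ltW kap0) sh; lra.
(* Chain two subgradient inequalities: [v] at [xu v] tested at [x], then [u] at [xu u] tested at
   [xu v]. *)
have /(_ x) := (subdifferentialP _ _ _ _ fb).1 vsub; apply: le_trans.
have /(_ (xu v)) := (subdifferentialP _ _ _ _ fm).1 (xu_sub _ ur).
rewrite fb !lee_fin => mb.
have hle : h (xu v - xu u) <= t / 2.
  have := dual_normP h (xu v - xu u); rewrite -normr_dualE.
  have := ler_wpM2r (normr_ge0 (xu v - xu u)) h1.
  have := ler_norm (h (xu v - xu u)); lra.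
have -> : v (x - xu v) = u (x - xu u) - u (xu v - xu u) +
    s * (h (x - xu u) - h (xu v - xu u)) :> R.
  have -> : x - xu v = (x - xu u) - (xu v - xu u).
    by rewrite opprB addrA subrK.
  by rewrite /v dualD dualZ !linearB.
rewrite ht.
have : s * (t / 2) <= s * (t - h (xu v - xu u)) by rewrite ler_pM2l//; lra.
suff : phi (tau / 2 * t) / (tau / c) <= s * (t / 2) by lra.
have b0 : 0 < tau * (t / 2) by rewrite !mulr_gt0// invr_gt0.
have := slope_le_right_derivative _ phi_convex phi_diff _ b0.
rewrite phi0 subr0 ler_pdivrMr// (_ : tau / 2 * t = tau * (t / 2)); last ring.
move=> slope; rewrite ler_pdivrMr ?divr_gt0// /s.
rewrite [leRHS](_ : _ = right_derivative phi (tau * (t / 2)) *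
                        (tau * (t / 2)))//.
by field; rewrite lt0r_neq0.
Qed.

End local_well_posedness.

Theorem corollary3p5 (R : realType) (X : completeNormedModType R)
    (phi : R -> R) (f : X -> \bar R) (xbar : X)
    (phi_admissible : admissible phi)
    (phi_strictly_convex : strictly_convex_Rplus phi)
    (phi_differentiable : differentiable_Rplus phi)
    (dphi_admissible : admissible (right_derivative phi))
    (f_proper : proper_function f)
    (f_lsc : lower_semicontinuous f)
    (f_convex : ereal_convex f)
    (xbar_dom : effective_dom f xbar) :
  SLWP phi f xbar <->
  strongly_metrically_regular (right_derivative phi) (subdifferential f)
    xbar (0 : dual_space X).
Proof. by split; [exact: SLWP_regular|exact: regular_SLWP]. Qed.
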